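(* Let $\beta>0$, let $\mu_{\rm e}$ be the equilibrium steady state with density $\rho_{\rm e}=Z_{\rm e}^{-1}e^{-\beta H}$, and let $\mu_{\rm ne}$ be the nonequilibrium steady state of the Langevin dynamics coupled to two heat baths at temperatures $T_L,T_R>0$ (both described in the context), where $\mu_{\rm e}$ and $\mu_{\rm ne}$ are probability measures on $\mathbb{R}^{2Nd}$ with strictly positive densities $\rho_{\rm e},\rho_{\rm ne}>0$, and $\log(d\mu_{\rm ne}/d\mu_{\rm e})$ is integrable with respect to $\mu_{\rm ne}$. Assume that there exists a function $G\colon\mathbb{R}^{2Nd}\to\mathbb{R}$ with $-\beta G\in\mathcal{A}(\mu_{\rm e})$ (that is, $-\beta G$ is measurable, bounded from below, and $e^{-\beta G}\in L^1(\mu_{\rm e})$) such that $$\frac{d\mu_{\rm ne}}{d\mu_{\rm e}}=\frac{\rho_{\rm ne}}{\rho_{\rm e}}=e^{c(\beta)-\beta G},\qquad c(\beta):=-\log \mathbf{E}_{\mu_{\rm e}}\big[e^{-\beta G}\big].$$ Then $$\mathbf{E}_{\mu_{\rm ne}}[G]\;\le\;-\beta^{-1}\log\mathbf{E}_{\mu_{\rm e}}\big[e^{-\beta G}\big]\;\le\;\mathbf{E}_{\mu_{\rm e}}[G].$$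
   Context: Setting. Let $N\ge 1$, $d\in\{1,2,3\}$, and write $x=(q,p)\in\mathbb{R}^{2Nd}$ with $q=(q_1,\dots,q_N)$, $p=(p_1,\dots,p_N)$, $q_i,p_i\in\mathbb{R}^d$. The Hamiltonian is $$H(q,p)=\sum_{i=1}^N\Big(\frac{|p_i|^2}{2m_i}+V(q_i)+\sum_{j>i}U(q_j-q_i)\Big),$$ with masses $m_i>0$ and smooth potentials $V,U\colon\mathbb{R}^d\to\mathbb{R}$ that are bounded below, $V$ growing polynomially at infinity. It is assumed that $Z_{\rm e}=\int e^{-\beta H}\,dq\,dp<\infty$; $\mu_{\rm e}$ is the probability measure with density $\rho_{\rm e}=Z_{\rm e}^{-1}e^{-\beta H}$ with respect to Lebesgue measure. Nonequilibrium dynamics. Let $L,R\subset\{1,\dots,N\}$ be disjoint, $\gamma>0$, and $T_L,T_R>0$. The Langevin dynamics is $$dq_i=\frac{\partial H}{\partial p_i}dt\ (i=1,\dots,N),\qquad dp_i=-\frac{\partial H}{\partial q_i}dt\ (i\notin L\cup R),$$ $$dp_i=-\Big(\frac{\partial H}{\partial q_i}+\gamma\frac{\partial H}{\partial p_i}\Big)dt+\sqrt{2\gamma T_L}\,dW_i\ (i\in L),\qquad dp_i=-\Big(\frac{\partial H}{\partial q_i}+\gamma\frac{\partial H}{\partial p_i}\Big)dt+\sqrt{2\gamma T_R}\,dW_i\ (i\in R),$$ with independent standard $d$-dimensional Brownian motions $W_i$. The nonequilibrium steady state $\mu_{\rm ne}$ is the (assumed unique) invariant probability measure of this dynamics, i.e.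 $\int \mathcal{G}f\,d\mu_{\rm ne}=0$ for all smooth compactly supported $f$, where $\mathcal{G}$ is the generator of the dynamics; $\rho_{\rm ne}$ is its Lebesgue density. Notation. $\mathbf{E}_\mu[\cdot]$ denotes expectation with respect to the probability measure $\mu$. For a probability measure $\nu$, $\mathcal{A}(\nu)$ is the set of all measurable real functions $\varphi$ that are bounded from below and satisfy $e^{\varphi}\in L^1(\nu)$. The function $G$ is called the potential associated with the likelihood ratio between $\mu_{\rm ne}$ and $\mu_{\rm e}$. *)

(* Defs.v *)
From HB Require Import structures.
From mathcomp Require Import all_boot all_order all_algebra.
From mathcomp Require Import all_classical all_reals all_analysis.
From mathcomp Require Import measurable_realfun.

Set Implicit Arguments.
Unset Strict Implicit.
Unset Printing Implicit Defensive.

Import Order.TTheory GRing.Theory Num.Theory.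
Import numFieldNormedType.Exports.

Local Open Scope classical_set_scope.
Local Open Scope ring_scope.

Fact borel_mx_display : measure_display.
Proof. exact: default_measure_display. Qed.

Section borel_matrices.
Context {R : realType} (m n : nat).

Definition borel_mx : set (set 'M[R]_(m, n)) := <<s [set U | open U] >>.

Let borel_mx0 : borel_mx set0. Proof. exact: sigma_algebra0. Qed.

Let borel_mxC A : borel_mx A -> borel_mx (~` A).
Proof. exact: sigma_algebraC. Qed.

Let borel_mx_bigcup (F : (set 'M[R]_(m, n))^nat) :
  (forall i, borel_mx (F i)) -> borel_mx (\bigcup_i F i).
Proof. exact: sigma_algebra_bigcup. Qed.

HB.instance Definition _ := @isMeasurable.Build borel_mx_display
  'M[R]_(m, n) borel_mx borel_mx0 borel_mxC borel_mx_bigcup.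

Lemma measurable_coord (i : 'I_m) (j : 'I_n) :
  measurable_fun [set: 'M[R]_(m, n)] (fun M => M i j).
Proof.
apply: (measurability _ (RGenOpens.measurableE R)) => _ [_ [a [b ->]] <-].
rewrite setTI; apply: sub_sigma_algebra => /=.
by apply: open_comp => [M _|]; [exact: coord_continuous|exact: interval_open].
Qed.

End borel_matrices.

Lemma measurable_mxP d (T : measurableType d) (R : realType) (m n : nat)
    (f : T -> 'M[R]_(m, n)) :
  measurable_fun [set: T] f <->
  forall i j, measurable_fun [set: T] (fun x => f x i j).
Proof.
split=> [mf i j|mf]; first exact: (measurableT_comp (measurable_coord i j) mf).
apply: (@measurability _ _ T 'M[R]_(m, n) setT f [set U | open U] erefl).
move=> _ [U oU <-].
pose B (ar : 'M[rat]_(m, n) * rat) : set 'M[R]_(m, n) :=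
  [set M | forall i j, `|ratr (ar.1 i j) - M i j| < ratr ar.2].
pose F ar := if `[< B ar `<=` U >] then f @^-1` B ar else set0.
have -> : [set: T] `&` f @^-1` U = \bigcup_ar F ar.
  rewrite setTI; apply/seteqP; split=> [x Ufx|x [ar _]]; last first.
    by rewrite /F; case: asboolP => // BU /BU.
  have [e /= e0 eU] := (nbhs_ballP _ _).1 (open_nbhs_nbhs (conj oU Ufx)).
  have /rat_in_itvoo[q] : 0 < e / 2 by rewrite divr_gt0.
  rewrite in_itv/= => /andP[q0 qe].
  have /choice[a aP] (ij : 'I_m * 'I_n) : exists a : rat,
      `|ratr a - f x ij.1 ij.2| < ratr q.
    have /rat_in_itvoo[a] : f x ij.1 ij.2 - ratr q < f x ij.1 ij.2 + ratr q.
      by rewrite ltrD2l gtrN.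
    by rewrite in_itv/= => ax; exists a; rewrite ltr_distl.
  pose ar := (\matrix_(i, j) a (i, j), q) : 'M[rat]_(m, n) * rat.
  have Bx : B ar (f x) by move=> i j /=; rewrite mxE; exact: (aP (i, j)).
  exists ar => //; rewrite /F; case: asboolP => // -[] M BM; apply: eU.
  split=> // i j; rewrite /ball/=.
  rewrite (le_lt_trans (ler_distD (ratr (ar.1 i j)) _ _))// (splitr e).
  apply: ltrD; apply: lt_trans qe; last exact: BM.
  by rewrite distrC; exact: Bx.
apply: countable_bigcupT_measurable => [|ar]; first exact: countableP.
rewrite /F; case: asboolP => // _.
rewrite (_ : f @^-1` _ = \bigcap_(i in [set: 'I_m]) \bigcap_(j in [set: 'I_n])
    [set x | `|ratr (ar.1 i j) - f x i j| < ratr ar.2]); last first.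
  by apply/seteqP; split=> x /= Bx => [i _ j _|i j]; exact: Bx.
apply: fin_bigcap_measurable => // i _; apply: fin_bigcap_measurable => // j _.
have mh : measurable_fun [set: T] (fun x => `|ratr (ar.1 i j) - f x i j|).
  by apply: measurableT_comp => //; exact: measurable_funB.
have := mh measurableT `]-oo, ratr ar.2[%classic (measurable_itv _).
by rewrite setTI; congr (measurable _); apply/seteqP; split=> x; rewrite /= in_itv.
Qed.

(* The library proves this only as a section-local fact, and its canonical
   instance is shadowed by the one for products of sub-probabilities. *)
Lemma sigma_finite_product d1 d2 (T1 : measurableType d1)
    (T2 : measurableType d2) (R : realType)
    (m1 : {sigma_finite_measure set T1 -> \bar R})
    (m2 : {sigma_finite_measure set T2 -> \bar R}) :
  sigma_finite setT (m1 \x m2)%E.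
Proof.
have /sigma_finiteP[F [TF ndF Foo]] := sigma_finiteT m1.
have /sigma_finiteP[G [TG ndG Goo]] := sigma_finiteT m2.
exists (fun n => F n `*` G n).
  rewrite -setXTT TF TG predeqE => -[x y]; split.
    move=> [/= [n _ Fnx] [k _ Gky]]; exists (maxn n k) => //; split.
    - by move: x Fnx; exact/subsetPset/ndF/leq_maxl.
    - by move: y Gky; exact/subsetPset/ndG/leq_maxr.
  by move=> [n _ []/= ? ?]; split; exists n.
move=> k; have [? ?] := Foo k; have [? ?] := Goo k.
split; first exact: measurableX.
by rewrite product_measure1E// lte_mul_pinfty// ge0_fin_numE.
Qed.

Section transport.
Context d1 d2 (T1 : measurableType d1) (T2 : measurableType d2) (R : realType).
Variables (mu : {measure set T1 -> \bar R}) (f : T1 -> T2) (g : T2 -> T1).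
Hypotheses (smu : sigma_finite setT mu).
Hypotheses (mf : measurable_fun setT f) (mg : measurable_fun setT g).
Hypothesis fK : cancel f g.

(* The unused arguments make the sigma-finiteness of the push-forward
   inferable. *)
Definition transport of sigma_finite setT mu & measurable_fun setT f
  & measurable_fun setT g & cancel f g := pushforward mu f.

Local Notation nu := (transport smu mf mg fK).

Let transport0 : nu set0 = 0%E.
Proof. by rewrite /transport /pushforward preimage_set0 measure0. Qed.

Let transport_ge0 A : (0 <= nu A)%E. Proof. exact: measure_ge0. Qed.

Let transport_sigma_additive : semi_sigma_additive nu.
Proof.
by have := @measure_semi_sigma_additive _ _ _ (pushforward mu f); exact.
Unshelve. all: exact: mf.
Qed.

HB.instance Definition _ := isMeasure.Build _ _ _ nu
  transport0 transport_ge0 transport_sigma_additive.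

Let transport_sigma_finite : sigma_finite setT nu.
Proof.
have [F TF Foo] := smu.
exists (fun k => g @^-1` F k); first by rewrite -preimage_bigcup -TF.
move=> k; have [mF Fk] := Foo k; split.
  by rewrite -[X in measurable X]setTI; exact: mg.
rewrite /= /transport /pushforward -comp_preimage (_ : g \o f = id) ?preimage_id//.
by apply/funext => x /=; rewrite fK.
Qed.

HB.instance Definition _ := Measure_isSigmaFinite.Build _ _ _ nu
  transport_sigma_finite.

End transport.

Section lebesgue_rV.
Context {R : realType}.

Definition rV_cons n (z : R * 'rV[R]_n) : 'rV[R]_n.+1 :=
  row_mx (const_mx z.1 : 'M[R]_(1, 1)) z.2.

Definition rV_uncons n (v : 'rV[R]_n.+1) : R * 'rV[R]_n :=
  (v 0 0, rsubmx (v : 'rV[R]_(1 + n))).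

Lemma rV_cons0 n (z : R * 'rV[R]_n) i : rV_cons z i 0 = z.1.
Proof.
by rewrite (_ : 0 = lshift n 0 :> 'I_(1 + n)) ?[LHS]row_mxEl ?mxE//; apply: val_inj.
Qed.

Lemma rV_consS n (z : R * 'rV[R]_n) i j : rV_cons z i (lift 0 j) = z.2 i j.
Proof.
by rewrite (_ : lift 0 j = rshift 1 j :> 'I_(1 + n)) ?[LHS]row_mxEr//; apply: val_inj.
Qed.

Lemma rV_consK n : cancel (@rV_cons n) (@rV_uncons n).
Proof.
by move=> [a v]; rewrite /rV_uncons rV_cons0 row_mxKr.
Qed.

Lemma measurable_rV_cons n : measurable_fun setT (@rV_cons n).
Proof.
apply/measurable_mxP => i j; case: (unliftP 0 j) => [k|] ->.
  apply: (eq_measurable_fun (fun z : R * 'rV[R]_n => z.2 i k)) => [z _|].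
    by rewrite rV_consS.
  exact: (measurableT_comp (measurable_coord i k) measurable_snd).
apply: (eq_measurable_fun fst) => [z _|]; last exact: measurable_fst.
by rewrite rV_cons0.
Qed.

Lemma measurable_rV_uncons n : measurable_fun setT (@rV_uncons n).
Proof.
apply: measurable_fun_pair; first exact: measurable_coord.
apply/measurable_mxP => i j.
apply: (eq_measurable_fun (fun v : 'rV[R]_n.+1 => v i (rshift 1 j))) => [v _|].
  by rewrite mxE.
exact: measurable_coord.
Qed.

Fixpoint lebesgue_rV n : {sigma_finite_measure set 'rV[R]_n -> \bar R} :=
  match n with
  | 0 => \d_(0 : 'rV[R]_0)
  | n'.+1 => transport (sigma_finite_product lebesgue_measure (lebesgue_rV n'))
      (@measurable_rV_cons n') (@measurable_rV_uncons n') (@rV_consK n')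
  end.

Lemma lebesgue_rV_box n (A : 'I_n -> set R) : (forall j, measurable (A j)) ->
  lebesgue_rV n [set v | forall j, A j (v 0 j)] =
  (\prod_(j < n) lebesgue_measure (A j))%E.
Proof.
elim: n A => [|n IH] A mA.
  by rewrite big_ord0 /= diracE mem_set// => -[].
rewrite big_ord_recl -(IH (fun j => A (lift 0 j)))//.
have mbox : measurable [set v : 'rV[R]_n | forall j, A (lift 0 j) (v 0 j)].
  rewrite (_ : mkset _ = \bigcap_(j in [set: 'I_n])
      ((fun v : 'rV[R]_n => v 0 j) @^-1` A (lift 0 j))).
    apply: fin_bigcap_measurable => // j _.
    by rewrite -[X in measurable X]setTI; exact: measurable_coord.
  by apply/seteqP; split=> v /= Av => [j _|j]; exact: Av.
rewrite /= /transport /pushforward -product_measure1E//; last exact: mA.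
congr (product_measure1 _ _ _); apply/seteqP; split=> z /= Az.
  split=> [|j]; first by have := Az 0; rewrite rV_cons0.
  by have := Az (lift 0 j); rewrite rV_consS.
move=> j; case: (unliftP 0 j) => [k|] ->; first by rewrite rV_consS; exact: Az.2.
by rewrite rV_cons0; exact: Az.1.
Qed.

End lebesgue_rV.

Section lebesgue_mx.
Context {R : realType} (m n : nat).

Lemma measurable_vec_mx : measurable_fun setT (@vec_mx R m n).
Proof.
apply/measurable_mxP => i j.
apply: (eq_measurable_fun (fun v : 'rV[R]_(m * n) => v 0 (mxvec_index i j))).
  by move=> v _; rewrite mxE.
exact: measurable_coord.
Qed.

Lemma measurable_mxvec : measurable_fun setT (@mxvec R m n).
Proof.
apply/measurable_mxP => i j; rewrite ord1.
case/mxvec_indexP: j => k l.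
apply: (eq_measurable_fun (fun M : 'M[R]_(m, n) => M k l)).
  by move=> M _; rewrite mxvecE.
exact: measurable_coord.
Qed.

Definition lebesgue_mx : {sigma_finite_measure set 'M[R]_(m, n) -> \bar R} :=
  transport (sigma_finiteT (lebesgue_rV (m * n))) measurable_vec_mx measurable_mxvec
    (@vec_mxK R m n).

Lemma lebesgue_mx_box (A : 'I_m -> 'I_n -> set R) :
  (forall i j, measurable (A i j)) ->
  lebesgue_mx [set M | forall i j, A i j (M i j)] =
  (\prod_(i < m) \prod_(j < n) lebesgue_measure (A i j))%E.
Proof.
move=> mA; pose B k := let ij := enum_val (cast_ord (esym (mxvec_cast m n)) k) in
  A ij.1 ij.2.
have BE i j : B (mxvec_index i j) = A i j.
  by rewrite /B /mxvec_index cast_ordK enum_rankK.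
transitivity (lebesgue_rV (m * n) [set v | forall k, B k (v 0 k)]).
  congr (lebesgue_rV _ _); apply/seteqP; split=> v /= Av.
    by move=> k; case/mxvec_indexP: k => i j; have := Av i j; rewrite BE mxE.
  by move=> i j; have := Av (mxvec_index i j); rewrite BE mxE.
rewrite lebesgue_rV_box => [|k]; last exact: mA.
rewrite pair_bigA (reindex (uncurry (@mxvec_index m n)))/=.
  by apply: eq_bigr => -[i j] _; rewrite /= BE.
exact: curry_mxvec_bij.
Qed.

End lebesgue_mx.

Definition bounded_below (R : realType) (T : Type) (f : T -> R) : Prop :=
  exists C, forall x, C <= f x.

Section smooth.
Context {R : realType} {V : normedModType R}.

Definition iter_derive (vs : seq V) (f : V -> R) : V -> R :=
  foldr (fun v g => 'D_v g) f vs.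

(* In finite dimension this is C^oo. *)
Definition smooth (f : V -> R) : Prop := forall vs,
  continuous (iter_derive vs f) /\
  forall x v, derivable (iter_derive vs f) x v.

Definition compactly_supported (f : V -> R) : Prop :=
  compact (closure [set x | f x != 0]).

End smooth.

Section euclidean.
Context {R : realType} (d : nat).

Definition sqnorm (v : 'rV[R]_d) : R := \sum_k v 0 k ^+ 2.

(* Two-sided power bounds at infinity; the two exponents may differ, as for
   q_1^2 + q_2^4. *)
Definition polynomial_growth (V : 'rV[R]_d -> R) : Prop :=
  exists a b c C r : R, [/\ 0 < a, 0 < c &
    forall q, r <= Num.sqrt (sqnorm q) ->
      c * Num.sqrt (sqnorm q) `^ a <= V q <= C * Num.sqrt (sqnorm q) `^ b].

End euclidean.

(* A point of R^(2Nd) is a pair (q, p) of matrices whose i-th rows are q_i, p_i. *)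

Notation phase R N d := ('M[R]_(N, d) * 'M[R]_(N, d))%type.

Definition lebesgue_phase (R : realType) (N d : nat) :
  {measure set (phase R N d) -> \bar R} :=
  (lebesgue_mx N d \x lebesgue_mx N d)%E.

Section densities.
Context {R : realType} {N d : nat}.

Definition is_density (mu : probability (phase R N d) R)
    (rho : phase R N d -> R) : Prop :=
  measurable_fun setT rho /\
  forall A, measurable A ->
    mu A = (\int[lebesgue_phase R N d]_(x in A) (rho x)%:E)%E.

End densities.

Section hamiltonian.
Context {R : realType} {N d : nat}.
Variables (m : 'I_N -> R) (V U : 'rV[R]_d -> R).

Definition hamiltonian (x : phase R N d) : R :=
  let: (q, p) := x in
  \sum_(i < N) (sqnorm (row i p) / (2 * m i) + V (row i q)
    + \sum_(j < N | (i < j)%N) U (row j q - row i q)).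

Definition partition_function (beta : R) : \bar R :=
  (\int[lebesgue_phase R N d]_x (expR (- beta * hamiltonian x))%:E)%E.

Definition rho_eq (beta : R) (x : phase R N d) : R :=
  (fine (partition_function beta))^-1 * expR (- beta * hamiltonian x).

Definition dq (i : 'I_N) (k : 'I_d) (f : phase R N d -> R) : phase R N d -> R :=
  'D_(delta_mx i k, 0) f.

Definition dp (i : 'I_N) (k : 'I_d) (f : phase R N d -> R) : phase R N d -> R :=
  'D_(0, delta_mx i k) f.

Variables (Lb Rb : {set 'I_N}) (gamma TL TR : R).

Definition drift_q (i : 'I_N) (k : 'I_d) (x : phase R N d) : R :=
  dp i k hamiltonian x.

Definition drift_p (i : 'I_N) (k : 'I_d) (x : phase R N d) : R :=
  if i \in Lb :|: Rb
  then - (dq i k hamiltonian x + gamma * dp i k hamiltonian x)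
  else - dq i k hamiltonian x.

Definition noise_p (i : 'I_N) : R :=
  if i \in Lb then Num.sqrt (2 * gamma * TL)
  else if i \in Rb then Num.sqrt (2 * gamma * TR)
  else 0.

(* For dX = b(X) dt + s dW with constant diagonal s, the generator is
   sum_k b_k D_k + (1/2) sum_k s_k^2 D_k^2. *)
Definition generator (f : phase R N d -> R) (x : phase R N d) : R :=
  \sum_(i < N) \sum_(k < d)
    (drift_q i k x * dq i k f x + drift_p i k x * dp i k f x
     + 2^-1 * noise_p i ^+ 2 * dp i k (dp i k f) x).

Definition invariant_law (mu : probability (phase R N d) R) : Prop :=
  forall f, smooth f -> compactly_supported f ->
    (\int[mu]_x (generator f x)%:E = 0)%E.

Definition steady_state (mu : probability (phase R N d) R) : Prop :=
  invariant_law mu /\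
  forall nu, invariant_law nu -> forall A, measurable A -> nu A = mu A.

End hamiltonian.

Section potentials.
Context dd {T : measurableType dd} {R : realType}.

Definition classA (nu : probability T R) : set (T -> R) :=
  [set phi | [/\ measurable_fun setT phi, bounded_below phi &
    nu.-integrable setT (fun x => (expR (phi x))%:E)]].

Definition normalizer (nu : probability T R) (beta : R) (G : T -> R) : R :=
  - ln (fine 'E_nu[fun x => expR (- beta * G x)]).

End potentials.

(* Main.v *)
(* Write [h = c - beta G], so that [e^h] is the likelihood ratio. From
   [1 + y <= e^y], any integrable [X] with [E e^X <= 1] has [E X <= 0]. With
   [X = h] under [mu_e], where [E e^h = 1] by the choice of [c], this bounds
   [E G] from below; with [X = - h] under [mu_ne], where [E e^(-h) = 1] by the change of
   variables [d mu_ne = e^h d mu_e], it bounds [E G] from above. *)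

Require Import Defs.
From HB Require Import structures.
From mathcomp Require Import all_boot all_order all_algebra.
From mathcomp Require Import all_classical all_reals all_analysis.
From mathcomp Require Import measurable_realfun.

Set Implicit Arguments.
Unset Strict Implicit.
Unset Printing Implicit Defensive.

Import Order.TTheory GRing.Theory Num.Theory.
Import numFieldNormedType.Exports.

Local Open Scope classical_set_scope.
Local Open Scope charge_scope.
Local Open Scope ring_scope.

Section density_dominates.
Local Open Scope ereal_scope.
Context dd (T : measurableType dd) (R : realType).
Variables la mu nu : {measure set T -> \bar R}.

(** If the integral of [f] over [A] vanishes, then [f] is zero almost everywhere on [A]; as [f] is
    never zero, [A] itself is [la]-null, hence [nu]-null. *)
Lemma positive_density_dominates (f g : T -> R) :
  measurable_fun setT f -> measurable_fun setT g -> (forall x, (0 < f x)%R) ->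
  (forall A, measurable A -> mu A = \int[la]_(x in A) (f x)%:E) ->
  (forall A, measurable A -> nu A = \int[la]_(x in A) (g x)%:E) ->
  nu `<< mu.
Proof.
move=> mf mg f0 muE nuE; apply/null_content_dominatesP => A mA muA0.
have mfA : measurable_fun A (EFin \o f).
  exact/measurable_EFinP/measurable_funTS.
have mgA : measurable_fun A (EFin \o g).
  exact/measurable_EFinP/measurable_funTS.
have /(ae_eq_integral_abs la mA mfA) f_ae0 :
    \int[la]_(x in A) `|(EFin \o f) x| = 0.
  rewrite -[RHS]muA0 [RHS]muE//; apply: eq_integral => x _.
  by rewrite /= ger0_norm// ltW.
suff laA0 : la A = 0 by rewrite nuE// null_set_integral.
(* Every point of [A] violates [f x = 0], so [A] lies inside the exceptional null set [N]. *)
have [N [mN laN0 subN]] := f_ae0; apply: subset_measure0 laN0 => //.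
move=> x Ax; apply: subN => /= /(_ Ax) [fx0].
by have := f0 x; rewrite fx0 ltxx.
Qed.

End density_dominates.

Section expectation_exp.
Local Open Scope ereal_scope.
Context dd (T : measurableType dd) (R : realType).

Lemma ae_eq_integrable (mu : {measure set T -> \bar R}) (f g : T -> \bar R) :
  measurable_fun setT g -> ae_eq mu setT f g ->
  mu.-integrable setT f -> mu.-integrable setT g.
Proof.
move=> mg fg /integrableP[mf foo]; apply/integrableP; split=> //.
suff -> : \int[mu]_x `|g x| = \int[mu]_x `|f x| by [].
apply: ae_eq_integral => //; [exact: measurableT_comp..|].
by apply: filterS fg => x /= /[apply] ->.
Qed.

(** The exponential controls the positive part and the lower bound [C] the negative part:
    [|X| <= e^X + |C|], which is integrable because [P] is finite. *)
Lemma integrable_of_expR (P : probability T R) (X : T -> R) :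
  measurable_fun setT X -> bounded_below X ->
  P.-integrable setT (fun x => (expR (X x))%:E) ->
  P.-integrable setT (EFin \o X).
Proof.
move=> mX [C CX] iX.
apply: (@le_integrable _ _ _ _ setT measurableT _
    (fun x => (expR (X x))%:E + `|C|%:E)) => //.
- exact/measurable_EFinP.
- move=> x _; rewrite -EFinD !abse_EFin lee_fin [leRHS]ger0_norm; last first.
    by rewrite addr_ge0// expR_ge0.
  have X_le_exp : (X x <= expR (X x))%R.
    by rewrite (le_trans _ (expR_ge1Dx _))// lerDr.
  have [X0|X0] := leP 0%R (X x).
    by rewrite ger0_norm// (le_trans X_le_exp)// lerDl.
  rewrite ltr0_norm// (@le_trans _ _ `|C|%R) ?lerDr ?expR_ge0//.
  by rewrite -normrN (le_trans _ (ler_norm (- C)%R))// lerN2.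
- by apply: integrableD => //; exact: finite_measure_integrable_cst.
Qed.

Lemma expectation_le0_expR (P : probability T R) (X : T -> R) :
  P.-integrable setT (EFin \o X) ->
  P.-integrable setT (fun x => (expR (X x))%:E) ->
  'E_P[fun x => expR (X x)] <= 1 -> 'E_P[X] <= 0.
Proof.
move=> iX ieX; rewrite !unlock => eX1.
have i1 := @finite_measure_integrable_cst _ _ _ P setT 1%R measurableT.
apply: (@le_trans _ _ (\int[P]_x ((expR (X x))%:E - (cst 1%:E) x))).
  apply: le_integral => //; first exact: integrableB.
  by move=> x _; rewrite -EFinB lee_fin lerBrDl expR_ge1Dx.
rewrite integralB//= integral_cst// mul1e [X in _ - X]probability_setT.
by rewrite sube_le0.
Qed.

Lemma expectation_affine (P : probability T R) (a b : R) (X : T -> R) :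
  P.-integrable setT (EFin \o X) ->
  'E_P[fun x => a - b * X x]%R = a%:E - b%:E * 'E_P[X].
Proof.
move=> iX; rewrite unlock.
have ia := @finite_measure_integrable_cst _ _ _ P setT a measurableT.
under eq_integral do rewrite EFinB EFinM.
rewrite integralB//; last exact: integrableZl.
by rewrite integral_cst// [X in _ * X - _]probability_setT mule1 integralZl.
Qed.

(** The expectation is at least [e^C] for any lower bound [C] of [X]. Positivity makes the logarithm
    in [normalizer] a genuine one, so that [lnK] applies. *)
Lemma expectation_expR_gt0 (P : probability T R) (X : T -> R) :
  bounded_below X -> P.-integrable setT (fun x => (expR (X x))%:E) ->
  (0 < fine 'E_P[fun x => expR (X x)])%R.
Proof.
move=> [C CX] ieX.
have iC := @finite_measure_integrable_cst _ _ _ P setT (expR C) measurableT.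
have : (expR C)%:E <= 'E_P[fun x => expR (X x)].
  rewrite unlock -[leLHS]mule1 -[X in _ * X](probability_setT P).
  rewrite -(integral_cst P measurableT (expR C)%:E); apply: le_integral => //.
  by move=> x _; rewrite lee_fin ler_expR.
have /fineK {1}<- : 'E_P[fun x => expR (X x)] \is a fin_num.
  by rewrite unlock; exact: integrable_fin_num.
by rewrite lee_fin; apply: lt_le_trans; exact: expR_gt0.
Qed.

End expectation_exp.

Theorem theorem3p1
  (R : realType) (N d : nat) (N_ge1 : (1 <= N)%N) (d_123 : (1 <= d <= 3)%N)
  (m : 'I_N -> R) (m_gt0 : forall i, 0 < m i)
  (V U : 'rV[R]_d -> R) (V_smooth : smooth V) (U_smooth : smooth U)
  (V_bounded : bounded_below V) (U_bounded : bounded_below U)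
  (V_growth : polynomial_growth V)
  (Lb Rb : {set 'I_N}) (disjoint_baths : [disjoint Lb & Rb]%B)
  (gamma TL TR beta : R)
  (gamma_gt0 : 0 < gamma) (TL_gt0 : 0 < TL) (TR_gt0 : 0 < TR)
  (beta_gt0 : 0 < beta)
  (Z_finite : (partition_function m V U beta < +oo)%E)
  (mu_e mu_ne : probability (phase R N d) R)
  (rho_ne : phase R N d -> R)
  (mu_e_density : is_density mu_e (rho_eq m V U beta))
  (mu_ne_density : is_density mu_ne rho_ne)
  (rho_e_gt0 : forall x, 0 < rho_eq m V U beta x)
  (rho_ne_gt0 : forall x, 0 < rho_ne x)
  (mu_ne_steady : steady_state m V U Lb Rb gamma TL TR mu_ne)
  (log_integrable : mu_ne.-integrable setT
    (fun x => lne (('d (charge_of_finite_measure mu_ne) '/d mu_e) x)))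
  (G : phase R N d -> R)
  (G_classA : classA mu_e (fun x => - beta * G x))
  (likelihood_ratio : {ae mu_e, forall x,
    ('d (charge_of_finite_measure mu_ne) '/d mu_e) x
      = (rho_ne x / rho_eq m V U beta x)%:E /\
    rho_ne x / rho_eq m V U beta x
      = expR (normalizer mu_e beta G - beta * G x)}) :
  ('E_mu_ne[G]
     <= (- beta^-1 * ln (fine 'E_mu_e[fun x => expR (- beta * G x)]))%:E)%E /\
  ((- beta^-1 * ln (fine 'E_mu_e[fun x => expR (- beta * G x)]))%:E
     <= 'E_mu_e[G])%E.
Proof.
have [mphi [C Cphi] iephi] := G_classA.
pose phi x := - beta * G x; pose c := normalizer mu_e beta G.
pose h x := c - beta * G x.
have beta_neq0 : beta != 0 by rewrite gt_eqF.
have mG : measurable_fun setT G.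
  rewrite (_ : G = fun x => (- beta^-1) * phi x); first exact: measurable_funM.
  by apply/funext => x; rewrite /phi mulrA mulrNN mulVf// mul1r.
have mh : measurable_fun setT h.
  by apply: measurable_funB => //; exact: measurable_funM.
have mexp (f : phase R N d -> R) : measurable_fun setT f ->
    measurable_fun setT (fun x => (expR (f x))%:E).
  by move=> mf; apply/measurable_EFinP; exact: measurableT_comp.
have hE x : h x = c + phi x by rewrite /h /phi mulNr.
have Z_gt0 : 0 < fine 'E_mu_e[fun x => expR (phi x)].
  by apply: expectation_expR_gt0 => //; exists C.
(* Integrability of [G] is recovered from that of [h] through [G = (c - h) / beta], under [mu_ne]
   for the upper bound on [c] side and under [mu_e] for the other. *)
have G_of_h (P : probability (phase R N d) R) :
    P.-integrable setT (EFin \o h) -> P.-integrable setT (EFin \o G).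
  move=> ih; apply: (@eq_integrable _ _ _ _ _ _
      (fun x => (beta^-1)%:E * ((cst c%:E x) - (h x)%:E)))%E => //.
    move=> x _; rewrite -EFinB -EFinM; congr (_%:E).
    by rewrite /h opprB addrC subrK mulKf.
  apply: integrableZl => //; apply: integrableB => //.
  exact: finite_measure_integrable_cst.
have exp_h x : ((expR (h x))%:E = (expR c)%:E * (expR (phi x))%:E)%E.
  by rewrite -EFinM -expRD hE.
have ieh : mu_e.-integrable setT (fun x => (expR (h x))%:E).
  by under eq_fun do rewrite exp_h; exact: integrableZl.
have Eeh : ('E_mu_e[fun x => expR (h x)] = 1)%E.
  rewrite unlock; under eq_integral do rewrite exp_h.
  rewrite integralZl//= /c /normalizer expRN lnK// -[X in (_ * X)%E]fineK.
    by rewrite -EFinM unlock mulVf// gt_eqF//; move: Z_gt0; rewrite unlock.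
  exact: integrable_fin_num.
(* Absolute continuity serves twice: it carries [mu_e]-almost sure identities over to [mu_ne], and
   it permits the change of variables. *)
have ne_e : mu_ne `<< mu_e.
  case: mu_e_density mu_ne_density => [mre mueE] [mrne mune].
  exact: positive_density_dominates mueE mune.
have /integrableP[mRN _] :
    mu_e.-integrable setT ('d (charge_of_finite_measure mu_ne) '/d mu_e).
  exact: Radon_Nikodym_integrable.
have RNE : ae_eq mu_e setT ('d (charge_of_finite_measure mu_ne) '/d mu_e)
    (fun x => (expR (h x))%:E).
  by apply: filterS likelihood_ratio => x [-> ->].
(* Under [mu_ne], [h] agrees almost everywhere with the logarithm of the Radon-Nikodym derivative,
   which is integrable by assumption. *)
have ih_ne : mu_ne.-integrable setT (EFin \o h).
  apply: ae_eq_integrable log_integrable; first exact/measurable_EFinP.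
  have := null_dominates_ae_eq measurableT ne_e RNE.
  apply: filterS => x /= /[apply] ->.
  by rewrite lne_EFin ?expR_gt0// expRK.
have mhN : measurable_fun setT (fun x => - h x) by exact: measurable_funN.
(* Since [h >= c + C], the function [e^(-h)] is bounded by the constant [e^(-(c + C))]. *)
have ieNh : mu_ne.-integrable setT (fun x => (expR (- h x))%:E).
  apply: (@le_integrable _ _ _ _ setT measurableT _
    (EFin \o cst (expR (- (c + C))))) => //; last 1 first.
  - exact: finite_measure_integrable_cst.
  - exact: mexp.
  - move=> x _; rewrite !abse_EFin lee_fin !ger0_norm ?expR_ge0//.
    by rewrite ler_expR lerN2 hE lerD2l Cphi.
have EeNh : ('E_mu_ne[fun x => expR (- h x)] = 1)%E.
  rewrite unlock -(Radon_Nikodym_change_of_variables ne_e)//.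
  rewrite (ae_eq_integral (cst 1%E))//.
  - by rewrite integral_cst// mul1e [LHS]probability_setT.
  - by apply: emeasurable_funM => //; exact: mexp.
  - apply: filterS RNE => x /= /[apply] ->.
    by rewrite -EFinM -expRD addNr expR0.
have -> : - beta^-1 * ln (fine 'E_mu_e[fun x => expR (- beta * G x)])
    = beta^-1 * c by rewrite mulNr mulrN.
(* Unfolded, [c] is an opposite, which [opprK] would see through. *)
clearbody c; split.
- have iG := G_of_h _ ih_ne.
  have ENh : ('E_mu_ne[fun x => (- h x)%R] <= 0)%E.
    apply: expectation_le0_expR => //; last by rewrite EeNh.
    exact: (integrableN ih_ne).
  (* The double sign gives [- h] the shape [a - b * X] of [expectation_affine]; the bound then reads
     [beta * E[G] <= c]. *)
  move: ENh; rewrite (_ : (fun x => - h x) = fun x => - c - (- beta) * G x).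
    rewrite expectation_affine//.
    have /fineK <- : 'E_mu_ne[G]%E \is a fin_num.
      by rewrite unlock; exact: integrable_fin_num.
    rewrite -EFinM -EFinB !lee_fin mulNr opprK addrC subr_le0.
    by rewrite ler_pdivlMl.
  by apply/funext => x; rewrite /h opprB mulNr opprK addrC.
(* Under [mu_e], integrability of [h] comes from its lower bound [c + C] and the integrability of
   [e^h]. *)
- have ih : mu_e.-integrable setT (EFin \o h).
    apply: integrable_of_expR => //; exists (c + C) => x.
    by rewrite hE lerD2l Cphi.
  have iG := G_of_h _ ih.
  have := expectation_le0_expR ih ieh; rewrite Eeh expectation_affine//.
  have /fineK <- : 'E_mu_e[G]%E \is a fin_num.
    by rewrite unlock; exact: integrable_fin_num.
  rewrite -EFinM -EFinB !lee_fin => /(_ (lexx _)).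
  by rewrite subr_le0 ler_pdivrMl.
Qed.
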